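(* Let $n \ge 1$ and let $\mathcal{A} \subseteq \mathbb{Z}^{n+1}$ be a finite set of pairs $(a,a_0)$ with $a \in \mathbb{Z}^n\setminus\{0\}$ and $a_0 \in \mathbb{Z}$, and let $m = |\mathcal{A}|$. There exists a deterministic algorithm which, given $\mathcal{A}$, computes $y \in \mathbb{Z}^n$ with $a^\top y \neq a_0$ for all $(a,a_0)\in\mathcal{A}$ such that: (1) the algorithm performs $O(n\cdot m)$ operations; (2) $\|y\|_1 \leq (m+n)/2$; (3) $y$ is lexicographically minimal in the following sense: for each $i \in \{1,\dots,n\}$, $|y_i|$ is minimum among all $z \in \mathbb{Z}^n$ satisfying $a^\top z \neq a_0$ for all $(a,a_0)\in\mathcal{A}$ and $|z_j| = |y_j|$ for all $j < i$.
   Context: Complexity is measured in the number of elementary (arithmetic) operations. *)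

(* Defs.v *)
From mathcomp Require Import all_boot all_order all_algebra finmap.

Set Implicit Arguments.
Unset Strict Implicit.
Unset Printing Implicit Defensive.

Import Order.TTheory GRing.Theory Num.Theory.
Local Open Scope ring_scope.

(* Computation model: a unit-cost arithmetic random access machine over the
   integers, with structured control flow.  A program has variables (indexed by
   [nat]; a program mentions finitely many of them) and a memory with indirect
   addressing.  Programs are finite syntax, so a single program has to handle
   all input sizes. *)

Definition var := nat.

Record state := State { vars : var -> int; mem : int -> int }.

Inductive arith := Add | Sub | Mul | Div.

(* [divz] is Euclidean division: the remainder is nonnegative, and x / 0 = 0. *)
Definition arith_eval (o : arith) : int -> int -> int :=
  match o with
  | Add => fun a b => a + b
  | Sub => fun a b => a - b
  | Mul => fun a b => a * b
  | Div => divz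
  end.

Inductive test := TestEq of var & var | TestLt of var & var.

Definition test_eval (b : test) (st : state) : bool :=
  match b with
  | TestEq x y => vars st x == vars st y
  | TestLt x y => vars st x < vars st y
  end.

Inductive prog :=
  | Skip
  | Const of var & int                (* x := c *)
  | Arith of arith & var & var & var  (* x := y o z *)
  | Read of var & var                 (* x := mem[y] *)
  | Write of var & var                (* mem[x] := y *)
  | Seq of prog & prog
  | If of test & prog & prog
  | While of test & prog.

Definition set_var (st : state) (x : var) (v : int) : state :=
  State (fun x' => if x' == x then v else vars st x') (mem st).

Definition set_mem (st : state) (a : int) (v : int) : state :=
  State (vars st) (fun a' => if a' == a then v else mem st a').

(* [exec P st t st']: started in [st], the program [P] halts in [st'] after
   exactly [t] elementary operations.  Every assignment, arithmetic operation,
   memory access and evaluation of a test counts as one operation. *)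
Inductive exec : prog -> state -> nat -> state -> Prop :=
  | ExecSkip st : exec Skip st 0 st
  | ExecConst x c st : exec (Const x c) st 1 (set_var st x c)
  | ExecArith o x y z st :
      exec (Arith o x y z) st 1
        (set_var st x (arith_eval o (vars st y) (vars st z)))
  | ExecRead x y st : exec (Read x y) st 1 (set_var st x (mem st (vars st y)))
  | ExecWrite x y st : exec (Write x y) st 1 (set_mem st (vars st x) (vars st y))
  | ExecSeq P Q st st1 st2 t1 t2 :
      exec P st t1 st1 -> exec Q st1 t2 st2 ->
      exec (Seq P Q) st (t1 + t2)%N st2
  | ExecIfTrue b P Q st st1 t :
      test_eval b st -> exec P st t st1 -> exec (If b P Q) st t.+1 st1
  | ExecIfFalse b P Q st st1 t :
      ~~ test_eval b st -> exec Q st t st1 -> exec (If b P Q) st t.+1 st1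
  | ExecWhileFalse b P st :
      ~~ test_eval b st -> exec (While b P) st 1 st
  | ExecWhileTrue b P st st1 st2 t1 t2 :
      test_eval b st -> exec P st t1 st1 -> exec (While b P) st1 t2 st2 ->
      exec (While b P) st (t1 + t2).+1 st2.

Lemma exec_deterministic P st t1 st1 t2 st2 :
  exec P st t1 st1 -> exec P st t2 st2 -> t1 = t2 /\ st1 = st2.
Proof.
move=> e1; elim: e1 t2 st2 => {P st t1 st1}; intros;
  match goal with h : exec _ _ _ _ |- _ => inversion h; subst; clear h end;
  repeat match goal with
  | ih : (forall t s, exec ?P ?st t s -> _), h : exec ?P ?st _ _ |- _ =>
      have [? ?] := ih _ _ h; subst; clear h
  | h1 : is_true (test_eval ?b ?st), h2 : is_true (~~ test_eval ?b ?st) |- _ =>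
      by rewrite h1 in h2
  end; by [].
Qed.

Section Hyperplanes.

Variable n : nat.

(* The pair (a, a0) stands for the hyperplane a^T x = a0. *)
Definition avoids (A : {fset 'cV[int]_n * int}) (y : 'cV[int]_n) : Prop :=
  forall p, p \in A -> (p.1^T *m y) 0 0 != p.2.

Definition l1norm (y : 'cV[int]_n) : int := \sum_(i < n) `|y i 0|.

Definition lex_minimal (A : {fset 'cV[int]_n * int}) (y : 'cV[int]_n) : Prop :=
  forall (i : 'I_n) (z : 'cV[int]_n),
    avoids A z -> (forall j : 'I_n, (j < i)%N -> `|z j 0| = `|y j 0|) ->
    `|y i 0| <= `|z i 0|.

(* Row of length n+1: a_1, ..., a_n, a0. *)
Definition encode (p : 'cV[int]_n * int) : seq int :=
  rcons [seq p.1 i 0 | i <- enum 'I_n] p.2.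

(* Input convention: variable 0 holds n, variable 1 holds the number m of
   hyperplanes, and memory cells 0, ..., m(n+1)-1 hold their entries one
   hyperplane after the other; everything else is 0. *)
Definition input_state (s : seq ('cV[int]_n * int)) : state :=
  State (fun x => (nth 0%N [:: n; size s] x)%:Z)
        (fun a => if a is Posz k then nth 0 (flatten (map encode s)) k else 0).

(* Output convention: memory cells 0, ..., n-1 hold the result on halting. *)
Definition output (st : state) : 'cV[int]_n := \col_(i < n) mem st (i : nat)%:Z.

End Hyperplanes.

(* Main.v *)
(* Call the last nonzero coordinate of a hyperplane its pivot.  Once the entries
   before i are fixed, each of the k_i hyperplanes with pivot i excludes a single
   value of y_i, so some y_i with |y_i| <= (k_i + 1) / 2 is left; since the k_i add
   up to m, these bounds add up to (m + n) / 2.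

   Lexicographic minimality fixes only the absolute values r_j of the earlier
   entries, so a candidate for |y_i| has to be tested against all sign vectors at
   once.  Unit-cost arithmetic on huge integers does this in O(i) operations.  Let
   Phi be the product of 2 (a^T x - a0)^2 over the hyperplanes with pivot at most
   i, evaluated at rapidly increasing integers X_0 << X_1 << ... in place of the
   coordinates.  As Phi(.., X_c, ..) and Phi(.., v, ..) are congruent modulo
   X_c - v and the latter is nonnegative and smaller than X_c - v, the remainder
   modulo X_c - v substitutes v for the c-th coordinate exactly.  Replacing D by
   (D mod (X_c - r_c)) + (D mod (X_c + r_c)) for c = i, ..., 0 therefore turns the
   value of Phi into the sum of Phi over all sign vectors, and this sum is nonzero
   iff some sign vector avoids all these hyperplanes.  The same test then fixes
   the signs one at a time, from the last coordinate to the first.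

   A test is run only for indices with k_i > 0, and at most k_i + 1 times for each
   of them, which keeps the total at O(n m). *)

From mathcomp Require Import all_boot all_order all_algebra finmap zify ring.
Require Import Defs.

Set Implicit Arguments.
Unset Strict Implicit.
Unset Printing Implicit Defensive.

Import Order.TTheory GRing.Theory Num.Theory.
Local Open Scope ring_scope.

(** * Substitution by remainders *)

Definition upd (x : nat -> int) (j : nat) (v : int) : nat -> int :=
  fun k => if k == j then v else x k.

Definition splice (c : nat) (x y : nat -> int) : nat -> int :=
  fun k => if (k < c)%N then x k else y k.

Section Elimination.

Variables X r : nat -> int.

Fixpoint eliminate (c : nat) (D : int) : int :=
  if c is c'.+1 then
    eliminate c' ((D %% (X c' - r c'))%Z + (D %% (X c' + r c'))%Z)
  else D.

(** When [r c = 0] both summands coincide and a vector counts twice; this is harmless, since only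
    the vanishing of the final sum matters. *)
Definition fold_sign (c : nat) (G : (nat -> int) -> int) (x : nat -> int) :=
  G (upd x c (r c)) + G (upd x c (- r c)).

Fixpoint sign_sum (c : nat) (G : (nat -> int) -> int) : (nat -> int) -> int :=
  if c is c'.+1 then sign_sum c' (fold_sign c' G) else G.

Variables (n d : nat) (H : int).

(* What is used of a nonnegative integer polynomial of degree at most [d]. *)
Record tame (K : int) (G : (nat -> int) -> int) : Prop := Tame {
  tame_ext : forall x y, x =1 y -> G x = G y;
  tame_dvd : forall (x : nat -> int) j u v, (u - v %| G (upd x j u) - G (upd x j v))%Z;
  tame_ge0 : forall x, 0 <= G x;
  tame_le : forall (B : int) (x : nat -> int), H <= B -> (forall j, (j < n)%N -> `|x j| <= B) ->
    G x <= K * B ^+ d }.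

Lemma tame_fold_sign K G c :
  0 <= r c <= H -> tame K G -> tame (K * 2) (fold_sign c G).
Proof.
move=> /andP[r0 rH] [ext dvd ge0 le]; split=> [x y xy|x j u v|x|B x HB xB].
- by congr (_ + _); apply: ext => k; rewrite /upd xy.
(* If [j = c], the second update erases the first; otherwise the two updates commute. *)
- have eqs w : (u - v %| G (upd (upd x j u) c w) - G (upd (upd x j v) c w))%Z.
    have [->|jc] := eqVneq j c.
      rewrite (ext (upd (upd x c u) c w) (upd (upd x c v) c w)) ?subrr ?dvdz0 //.
      by move=> k; rewrite /upd; case: (k == c).
    have swap t : upd (upd x j t) c w =1 upd (upd x c w) j t.
      by move=> k; rewrite /upd; case: (eqVneq k j) => // ->; rewrite (negPf jc).
    by rewrite !(ext _ _ (swap _)).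
  rewrite /fold_sign opprD addrACA; by apply: rpredD; apply: eqs.
- exact: addr_ge0.
have bd w : `|w| <= B -> G (upd x c w) <= K * B ^+ d.
  by move=> wB; apply: le => // j jn; rewrite /upd; case: ifP => // _; apply: xB.
rewrite -mulrA [2 * _]mulrC mulrA mulr_natr mulr2n /fold_sign.
by apply: lerD; apply: bd; lia.
Qed.

(** All summands are nonnegative, so a nonzero one cannot be cancelled. *)
Lemma sign_sum_neq0P K G c x :
  tame K G -> (forall j, (j < c)%N -> 0 <= r j <= H) ->
  reflect (exists y, [/\ forall j, (j < c)%N -> `|y j| = r j,
                         forall j, (c <= j)%N -> y j = x j & G y != 0])
          (sign_sum c G x != 0).
Proof.
elim: c K G => [|c ih] K G tG rH /=.
  apply: (iffP idP) => [h|[y [_ yx]]]; first by exists x; split.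
  by rewrite (tame_ext tG (y := x)) // => j; apply: yx.
have rc := rH c (ltnSn c).
have rH' j : (j < c)%N -> 0 <= r j <= H by move=> jc; apply: rH; lia.
apply: (iffP (ih _ _ (tame_fold_sign rc tG) rH')) => -[y [yr yx Gy]].
  have [s sr Gs] : exists2 s, `|s| = r c & G (upd y c s) != 0.
    have [h|h] := eqVneq (G (upd y c (r c))) 0; last by exists (r c) => //; lia.
    exists (- r c); first lia.
    by move: Gy; rewrite /fold_sign h add0r.
  exists (upd y c s); split => // j jc; rewrite /upd.
    by case: eqP => [->//|?]; apply: yr; lia.
  by case: eqP => [?|_]; [lia | apply: yx; lia].
(* The induction hypothesis asks for agreement with [x] at [c] too; [fold_sign] overwrites that
   entry anyway. *)
exists (upd y c (x c)); split=> [j jc|j jc|].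
- by rewrite /upd; case: eqP => [?|_]; [lia | apply: yr; lia].
- by rewrite /upd; case: eqP => [->//|?]; apply: yx; lia.
have Es s : s = y c -> G (upd (upd y c (x c)) c s) = G y.
  by move=> ->; apply: (tame_ext tG) => k; rewrite /upd; case: eqP => [->|].
have ge0 s := tame_ge0 tG (upd (upd y c (x c)) c s).
have := yr c (ltnSn c); have := tame_ge0 tG y.
have := Es (r c); have := Es (- r c); have := ge0 (r c); have := ge0 (- r c).
rewrite /fold_sign; move: (G _) (G _) (G y) Gy => p q g; lia.
Qed.

Variable lev : nat -> int.
Hypothesis lev0 : lev 0 = H.
Hypothesis levS : forall c, lev c ^+ d.+2 <= lev c.+1.
Hypothesis XE : forall c, X c = lev c.+1.
Hypothesis H_ge2 : 2 <= H.

Lemma lev_le (c c' : nat) : (c <= c')%N -> H <= lev c <= lev c'.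
Proof.
have step k : H <= lev k -> H <= lev k <= lev k.+1.
  move=> hk; rewrite hk (le_trans _ (levS k)) //.
  have h1 : 1 <= lev k by lia.
  by rewrite exprS ler_peMr ?exprn_ege1 //; lia.
have ge k : H <= lev k.
  by elim: k => [|k /step]; [rewrite lev0 | lia].
move=> cc'; rewrite ge /=; elim: c' cc' => [|k ih].
  by rewrite leqn0 => /eqP->.
rewrite leq_eqVlt => /predU1P[->//|/ih h].
by have := step k (ge k); lia.
Qed.

(** With [B = lev c], the substituted value is at most K B^d <= B^(d+1) / 2, whereas X_c - v >=
    B^(d+2) - B. The congruent value is therefore the remainder itself. *)
Lemma modz_tame K G c v (x : nat -> int) :
  tame K G -> (c < n)%N -> K * 2 <= H -> `|v| <= H ->
  (forall j, (j < n)%N -> `|x j| <= H) ->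
  (G (splice c.+1 X x) %% (X c - v))%Z = G (upd (splice c X x) c v).
Proof.
move=> [ext dvd ge0 le] cn KH vH xH.
have := dvd (splice c X x) c (X c) v.
rewrite -eqz_mod_dvd (ext _ (splice c.+1 X x)); last first.
  move=> k; rewrite /upd /splice ltnS; case: (ltngtP k c) => // ->; by [].
move=> /eqP ->; apply: modz_small; rewrite ge0 /= XE.
(* [X j] is [lev j.+1], hence at most [lev c] for [j < c]; so [B] bounds every coordinate that is
   left. *)
set B := lev c; have /andP[HB _] : H <= B <= lev c by exact: lev_le.
have bd : G (upd (splice c X x) c v) <= K * B ^+ d.
  apply: le => // j jn; rewrite /upd /splice; case: eqP => [_|jc]; first lia.
  case: ifP => [jc'|jc'].
    by have := lev_le jc'; rewrite XE -/B; lia.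
  by have := xH j; lia.
apply: le_lt_trans bd _.
have := levS c; rewrite -/B !exprS; have : 1 <= B ^+ d by apply: exprn_ege1; lia.
move: (B ^+ d) (lev c.+1) => p q p1 hq.
have h1 : 2 * (K * p) <= B * p by rewrite mulrA ler_wpM2r //; lia.
have h2 : 2 * (B * p) <= B * (B * p) by rewrite ler_wpM2r ?mulr_ge0 //; lia.
have h3 : B <= B * p by rewrite ler_peMr //; lia.
lia.
Qed.

(** Each round doubles the constant of [tame]; [K * 2 ^+ c <= H] leaves room for all [c] rounds. *)
Lemma eliminateE K G c (x : nat -> int) :
  tame K G -> (c <= n)%N -> K * 2 ^+ c <= H -> 0 <= K ->
  (forall j, (j < c)%N -> 0 <= r j <= H) ->
  (forall j, (j < n)%N -> `|x j| <= H) ->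
  eliminate c (G (splice c X x)) = sign_sum c G x.
Proof.
elim: c K G => [|c ih] K G tG cn KH K0 rH xH /=; first exact: (tame_ext tG).
have rc := rH c (ltnSn c).
have K2 : K * 2 <= H.
  by apply: le_trans KH; rewrite exprS ler_wpM2l // ler_peMr // exprn_ege1.
have -> : X c + r c = X c - - r c by rewrite opprK.
rewrite (modz_tame tG) //; last by lia.
rewrite (modz_tame tG) //; last by lia.
rewrite -[X in eliminate _ X]/(fold_sign c G (splice c X x)) (ih (K * 2)) //.
- exact: tame_fold_sign.
- by lia.
- by rewrite -mulrA -exprS.
- by lia.
- by move=> j jc; apply: rH; lia.
Qed.

End Elimination.

(** * Pivots and excluded values *)

(** The recursion mirrors a scan from left to right that overwrites a register at each nonzero
    entry. A zero row gets the default 0. *)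
Fixpoint last_nonzero (f : nat -> int) (j : nat) : nat :=
  if j is j'.+1 then if f j' == 0 then last_nonzero f j' else j' else 0.

Lemma last_nonzeroP f n :
  (exists2 j, (j < n)%N & f j != 0) ->
  [/\ (last_nonzero f n < n)%N, f (last_nonzero f n) != 0
    & forall k, (last_nonzero f n < k < n)%N -> f k = 0].
Proof.
elim: n => [|n ih] [j //= jn fj].
case: eqP => [fn|/eqP fn]; last by split => // k; lia.
have [|lt nz z] := ih.
  exists j => //; have [jn'|] := eqVneq j n; last by lia.
  by rewrite jn' fn eqxx in fj.
split=> // [|k hk]; first lia.
by have [->//|kn] := eqVneq k n; apply: z; lia.
Qed.

Section Arrangement.

Variables (n m : nat) (inp : nat -> int).

Definition row (h j : nat) : int := inp (h * n.+1 + j).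

Definition form (h : nat) (x : nat -> int) : int :=
  \sum_(j < n) row h j * x j - row h n.

Definition pivot (h : nat) : nat := last_nonzero (row h) n.

Definition pivots (i : nat) : nat := \sum_(h < m) (pivot h == i).

(* The factor 2 makes a product of weights differ from 1 unless it is empty, so
   that the program recognizes the indices without pivots. *)
Definition weight (h : nat) (x : nat -> int) : int := form h x ^+ 2 *+ 2.

Definition class_prod (i : nat) (x : nat -> int) : int :=
  \prod_(h < m) (if pivot h == i then weight h x else 1).

Definition prefix_prod (i : nat) (x : nat -> int) : int :=
  \prod_(h < m) (if (pivot h < i)%N then weight h x else 1).

(* Adding squares bounds the absolute values of the entries without a case
   distinction on signs; the doubling makes room for the 2 ^ m and 2 ^ n that come
   from the weights and from the sign vectors. *)
Fixpoint height_upto (k : nat) : int :=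
  if k is k'.+1 then height_upto k' *+ 2 + inp k' ^+ 2 else 1.

Definition height : int := height_upto (m * n.+1).

(* [m] rounds of three squarings; 8 ^ m >= 4 m + 2, where 4 m bounds the degree of a
   product of weights after the coefficients are absorbed into the base. *)
Fixpoint level (c : nat) : int :=
  if c is c'.+1 then level c' ^+ (8 ^ m) else height.

Definition point (j : nat) : int := level j.+1.

Hypothesis row_neq0 :
  forall h, (h < m)%N -> exists2 j, (j < n)%N & row h j != 0.

Lemma form_ext h x y : (forall j, (j < n)%N -> x j = y j) -> form h x = form h y.
Proof. by move=> xy; congr (_ - _); apply: eq_bigr => j _; rewrite xy. Qed.

Lemma form_upd h x j v :
  (j < n)%N -> form h (upd x j v) = form h x + row h j * (v - x j).
Proof.
move=> jn; rewrite /form (bigD1 (Ordinal jn)) //= [in RHS](bigD1 (Ordinal jn)) //=.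
rewrite /upd eqxx (eq_bigr (fun i : 'I_n => row h i * x i)); first by ring.
by move=> i; rewrite -val_eqE /= => /negPf ->.
Qed.

(** Coefficients after the pivot vanish, so a form with pivot below [i] reads only coordinates below
    [i]. *)
Lemma prefix_prod_ext i x y :
  (forall j, (j < i)%N -> x j = y j) ->
  prefix_prod i x = prefix_prod i y.
Proof.
move=> xy; apply: eq_bigr => h _; case: ifP => // hi.
have [_ _ z] := last_nonzeroP (row_neq0 (ltn_ord h)).
congr (_ ^+ 2 *+ 2); congr (_ - _); apply: eq_bigr => j _.
have [ji|ij] := ltnP j i; first by rewrite xy.
by rewrite z ?mul0r // ltn_ord andbT; apply: leq_trans ij.
Qed.

Lemma weight_ge0 h x : 0 <= weight h x.
Proof. by rewrite mulrn_wge0 // sqr_ge0. Qed.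

Lemma prefix_prodS i x : prefix_prod i.+1 x = prefix_prod i x * class_prod i x.
Proof.
rewrite -big_split; apply: eq_bigr => h _ /=; rewrite ltnS.
by case: ltngtP; rewrite ?mul1r ?mulr1.
Qed.

Lemma prefix_prod0 x : prefix_prod 0 x = 1.
Proof. by rewrite /prefix_prod big1. Qed.

Lemma weight_eq0 h x : (weight h x == 0) = (form h x == 0).
Proof. by rewrite mulrn_eq0 sqrf_eq0. Qed.

Lemma prefix_prod_neq0P i x :
  reflect (forall h, (h < m)%N -> (pivot h < i)%N -> form h x != 0)
          (prefix_prod i x != 0).
Proof.
apply: (iffP (prodf_neq0 _ _)) => [nz h hm hi|nz h _].
  by have := nz (Ordinal hm) isT; rewrite hi weight_eq0.
by case: ifP => // hi; rewrite weight_eq0 nz.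
Qed.

Lemma class_prod_eq1 i x : class_prod i x = 1 -> pivots i = 0%N.
Proof.
move=> e1; apply/eqP; rewrite sum_nat_eq0; apply/forallP => h /=.
rewrite eqb0; apply/negP => hi.
have : (2 %| class_prod i x)%Z.
  rewrite /class_prod (bigD1 h) //= hi dvdz_mulr // /weight -mulr_natr.
  exact: dvdz_mull.
by rewrite e1.
Qed.

Lemma pivots0_class_prod i x : pivots i = 0%N -> class_prod i x = 1.
Proof.
move=> /eqP; rewrite sum_nat_eq0 => /forallP k0; rewrite /class_prod big1 //.
by move=> h _; have := k0 h; rewrite eqb0 => /negPf ->.
Qed.

Lemma pivots_le i : (pivots i <= m)%N.
Proof.
rewrite -[leqRHS]card_ord -sum1_card; apply: leq_sum => h _; exact: leq_b1.
Qed.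

(** Double counting: each hyperplane has exactly one pivot, and it lies below [n]. *)
Lemma sum_pivots : (\sum_(i < n) pivots i)%N = m.
Proof.
rewrite exchange_big /= -[RHS]card_ord -sum1_card; apply: eq_bigr => h _.
have [lt _ _] := last_nonzeroP (row_neq0 (ltn_ord h)).
rewrite (bigD1 (Ordinal lt)) //= eqxx big1 ?addn0 // => j.
by rewrite -val_eqE /= eq_sym => /negPf ->.
Qed.

(** * Bounds and minimality of the absolute values, and the choice of signs *)

Definition signed (i : nat) (r x : nat -> int) : Prop :=
  forall j, (j < i)%N -> `|x j| = r j.

(** Each of the 2R - 1 integers of absolute value below [R] is excluded by some hyperplane with
    pivot [i], and one such hyperplane excludes at most one value. *)
Lemma excluded_le i y (R : nat) :
  (i < n)%N -> prefix_prod i y != 0 ->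
  (forall v : int, `|v| < R%:Z -> prefix_prod i.+1 (upd y i v) = 0) ->
  (2 * R <= (pivots i).+1)%N.
Proof.
move=> i_n yi ex; have [->//|R0] := posnP R.
(* Enumerates -(R - 1), ..., R - 1. *)
pose v (t : 'I_(2 * R - 1)) : int := t%:Z - (R.-1)%:Z.
have hit t : exists h : 'I_m, (pivot h == i) && (form h (upd y i (v t)) == 0).
  have := ex (v t); have -> : `|v t| < R%:Z.
    by rewrite /v; have := ltn_ord t; lia.
  move=> /(_ isT)/eqP; rewrite prefix_prodS mulf_eq0.
  rewrite (@prefix_prod_ext i _ y) ?(negPf yi); last first.
    by move=> j ji; rewrite /upd; case: eqP => //; lia.
  move=> /prodf_eq0[h _]; case: ifP => [hi|_]; last by rewrite oner_eq0.
  by rewrite weight_eq0 => h0; exists h; rewrite hi.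
pose f t := xchoose (hit t).
have fP t := xchooseP (hit t).
have inj_f : injective f.
  move=> s t st; have /andP[/eqP hi /eqP h0] := fP s.
  have /andP[_ /eqP h0'] := fP t; rewrite -/(f t) -st in h0'.
  rewrite -/(f s) in hi h0; rewrite !form_upd // in h0 h0'.
  have [_ nz _] := last_nonzeroP (row_neq0 (ltn_ord (f s))).
  rewrite -/(pivot _) hi in nz.
  (* The difference of two vanishing forms of the same hyperplane. *)
  have /eqP : row (f s) i * (v s - v t) = 0 by move: h0 h0'; lia.
  rewrite mulf_eq0 (negPf nz) /= /v => /eqP vst; apply: val_inj => /=; lia.
have : (#|codom f| <= pivots i)%N.
  rewrite /pivots -sum1_card; rewrite big_mkcond /=; apply: leq_sum => h _.
  case: ifP => // /codomP[t ->]; by have /andP[->] := fP t.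
rewrite card_codom // card_ord; lia.
Qed.

(** Only hyperplanes with pivot at most [i] are imposed. Vectors avoiding all hyperplanes are among
    those considered, so such a bound suffices for lexicographic minimality. *)
Definition at_least (i : nat) (r : nat -> int) (v : int) : Prop :=
  forall z, signed i r z -> prefix_prod i.+1 z != 0 -> v <= `|z i|.

Record minimal_upto (i : nat) (r : nat -> int) : Prop := MinimalUpto {
  minimal_feasible : exists2 y, signed i r y & prefix_prod i y != 0;
  minimal_at_least : forall k, (k < i)%N -> at_least k r (r k);
  minimal_range : forall k, (k < i)%N -> 0 <= r k /\ r k *+ 2 <= (pivots k).+1%:Z
}.

(** Limits both the norm and the number of candidates: after a feasible choice of the earlier signs,
    every value of absolute value below [v] is excluded. *)
Lemma at_least_le i r (v : nat) :
  (i < n)%N -> minimal_upto i r -> at_least i r v%:Z ->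
  (2 * v <= (pivots i).+1)%N.
Proof.
move=> i_n [[y ry yi] _ _] lb; apply: excluded_le yi _ => // w wv.
apply/eqP; apply: contraTT wv => nz; rewrite -leNgt.
have := lb (upd y i w); rewrite {3}/upd eqxx; apply=> // j ji.
by rewrite /upd; case: eqP => [?|_]; [lia | apply: ry].
Qed.

Lemma at_least_succ i r (v : nat) :
  at_least i r v%:Z -> ~ (exists2 y, signed i.+1 (upd r i v) y & prefix_prod i.+1 y != 0) ->
  at_least i r v.+1%:Z.
Proof.
move=> lb no z rz nz; have := lb z rz nz; rewrite le_eqVlt => /predU1P[e|//].
case: no; exists z => // j; rewrite ltnS /upd; case: eqP => [->//|ji jlt].
by apply: rz; lia.
Qed.

Lemma eq_at_least i r r' v :
  (forall j, (j < i)%N -> r j = r' j) -> at_least i r v -> at_least i r' v.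
Proof. by move=> rr lb z rz; apply: lb => j ji; rewrite rr // rz. Qed.

Lemma minimal_upto0 r : minimal_upto 0 r.
Proof. by split=> //; exists (fun=> 0) => //; rewrite prefix_prod0 oner_eq0. Qed.

Lemma minimal_uptoS i r (v : nat) :
  (i < n)%N -> minimal_upto i r -> at_least i r v%:Z ->
  (exists2 y, signed i.+1 (upd r i v) y & prefix_prod i.+1 y != 0) ->
  minimal_upto i.+1 (upd r i v).
Proof.
move=> i_n mr lb ex; have := at_least_le i_n mr lb; case: mr => _ lbs rng vle.
have rr k : (k < i)%N -> forall j, (j < k)%N -> r j = upd r i v j.
  by move=> ki j jk; rewrite /upd; case: eqP => //; lia.
split=> // k; rewrite ltnS leq_eqVlt => /predU1P[->|ki].
- rewrite {2}/upd eqxx; apply: eq_at_least lb => j ji.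
  by rewrite /upd; case: eqP => //; lia.
- rewrite {2}/upd; case: eqP => [|_]; first lia.
  by apply: eq_at_least (rr k ki) _; apply: lbs.
- by rewrite /upd eqxx; lia.
by rewrite /upd; case: eqP => [|_]; [lia | apply: rng].
Qed.

Lemma minimal_uptoS0 i r :
  (i < n)%N -> minimal_upto i r -> pivots i = 0%N ->
  minimal_upto i.+1 (upd r i 0).
Proof.
move=> i_n mr k0; apply: (@minimal_uptoS i r 0) => //; case: mr => [[y ry yi] _ _].
exists (upd y i 0).
  move=> j; rewrite ltnS /upd; case: eqP => // ji jle; apply: ry; lia.
rewrite prefix_prodS pivots0_class_prod // mulr1.
rewrite (@prefix_prod_ext i _ y) //.
by move=> j ji; rewrite /upd; case: eqP => //; lia.
Qed.

(* From index [c] on, [y] carries its final signs; below [c] it still holds the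
   absolute values. *)
Record settled (c : nat) (r y : nat -> int) : Prop := Settled {
  settled_abs : signed n r y;
  settled_ge0 : forall j, (j < c)%N -> 0 <= y j;
  settled_feasible : exists z, [/\ signed c y z,
    forall j, (c <= j)%N -> z j = y j & prefix_prod n z != 0]
}.

Lemma settled_eq0 c r y : settled c.+1 r y -> y c = 0 -> settled c r y.
Proof.
move=> [abs ge0 [z [yz zy zn]]] yc; split=> //; first by move=> j jc; apply: ge0; lia.
exists z; split=> // j jc; first by apply: yz; lia.
have [->|?] := eqVneq j c; last by apply: zy; lia.
by apply/eqP; rewrite yc -normr_eq0 yz // yc.
Qed.

Definition avoiding (x : nat -> int) : Prop :=
  forall h, (h < m)%N -> form h x != 0.

(** At [c = 0] the feasible vector agrees with [y] everywhere. The norm bound sums 2 r_j <= k_j + 1,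
    as the pivot counts k_j add up to [m]. *)
Lemma settled0_optimal r y :
  minimal_upto n r -> settled 0 r y ->
  [/\ avoiding y, (\sum_(j < n) `|y j|) *+ 2 <= (m + n)%:Z
    & forall i z, (i < n)%N -> avoiding z ->
        (forall j, (j < i)%N -> `|z j| = `|y j|) -> `|y i| <= `|z i|].
Proof.
move=> [_ lb rng] [abs _ [z [_ zy zn]]]; split.
- move=> h hm; rewrite (@form_ext h y z); last by move=> j _; rewrite zy.
  move/prefix_prod_neq0P: zn; apply => //.
  by have [] := last_nonzeroP (row_neq0 hm).
- have -> : (m + n)%:Z = \sum_(j < n) (pivots j).+1%:Z.
    rewrite -(big_morph Posz PoszD (erefl _)); congr Posz.
    rewrite (eq_bigr (fun j : 'I_n => pivots j + 1)%N) => [|j _]; last by rewrite addn1.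
    by rewrite big_split /= sum_pivots sum1_card card_ord.
  rewrite -sumrMnl; apply: ler_sum => j _.
  by rewrite abs //; have [] := rng j (ltn_ord j).
move=> i x i_n ax xy; rewrite abs //; apply: lb => // [j ji|].
  by rewrite xy // abs //; lia.
by apply/prefix_prod_neq0P => h hm _; apply: ax.
Qed.

(** * Size of the evaluation points and exactness of the tests *)

Hypothesis m_gt0 : (0 < m)%N.

Lemma height_upto_ge k : 2 ^+ k <= height_upto k.
Proof.
elim: k => //= k ih; rewrite exprS mulr2n.
by have := sqr_ge0 (inp k); move: (_ ^+ 2) (2 ^+ k) ih => a b; lia.
Qed.

Lemma height_upto_mono k k' : (k <= k')%N -> height_upto k <= height_upto k'.
Proof.
elim: k' => [|k' ih]; first by rewrite leqn0 => /eqP->.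
rewrite leq_eqVlt => /predU1P[->//|/ih h] /=; apply: le_trans h _.
have := sqr_ge0 (inp k'); have := height_upto_ge k'.
have : (0 : int) <= 2 ^+ k' by apply: exprn_ge0.
rewrite mulr2n; move: (_ ^+ 2) (2 ^+ k') => a b; lia.
Qed.

Lemma height_ge : 2 ^+ (m + n) <= height.
Proof.
apply: le_trans (height_upto_ge _); by rewrite ler_weXn2l // mulnS leq_add2l leq_pmull.
Qed.

Lemma height_gtm : m%:Z < height.
Proof.
apply: lt_le_trans height_ge; rewrite -natrX natz ltz_nat.
apply: (@leq_trans (2 ^ m)); first exact: ltn_expl.
by rewrite leq_exp2l //; lia.
Qed.

Lemma height_ge2 : 2 <= height.
Proof. have := height_gtm; lia. Qed.

(** Integers satisfy |a| <= a^2 and the cells of a row are consecutive, so the squares accumulated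
    in [height_upto] dominate the sum. *)
Lemma row_sum_le h :
  (h < m)%N -> \sum_(j < n.+1) `|row h j| <= height.
Proof.
move=> hm; apply: (@le_trans _ _ (height_upto (h * n.+1 + n.+1))); last first.
  by apply: height_upto_mono; rewrite addnC -mulSn leq_mul2r hm orbT.
suff le k : \sum_(j < k) `|row h j| <= height_upto (h * n.+1 + k) by apply: le.
have ge0 l : 0 <= height_upto l.
  by rewrite (le_trans _ (height_upto_ge _)) // exprn_ge0.
elim: k => [|k ih]; first by rewrite big_ord0.
rewrite big_ord_recr /= addnS /= -/(row h k).
have : `|row h k| <= row h k ^+ 2.
  rewrite -[leRHS]real_normK ?num_real // expr2.
  by have [->|nz] := eqVneq (row h k) 0; [rewrite normr0 | rewrite ler_peMr // -gtz0_ge1 normr_gt0].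
by apply: lerD; apply: le_trans ih _; rewrite mulr2n lerDl; apply: ge0.
Qed.

Lemma levelS c : level c ^+ (4 * m).+2 <= level c.+1.
Proof.
have lev_ge1 : 1 <= level c.
  elim: c => [|c ih] /=; last exact: exprn_ege1.
  by have := height_ge2; lia.
rewrite /= ler_weXn2l //; case: m m_gt0 => // k _.
by elim: k => // k; rewrite [(8 ^ k.+2)%N]expnS; lia.
Qed.

Lemma form_le h (B : int) (x : nat -> int) :
  (h < m)%N -> 1 <= B -> (forall j, (j < n)%N -> `|x j| <= B) ->
  `|form h x| <= height * B.
Proof.
move=> hm B1 xB; apply: (@le_trans _ _ ((\sum_(j < n.+1) `|row h j|) * B)).
  rewrite big_ord_recr /= mulrDl; apply: le_trans (ler_normB _ _) _.
  apply: lerD; last by rewrite ler_peMr.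
  rewrite mulr_suml; apply: le_trans (ler_norm_sum _ _ _) _.
  by apply: ler_sum => j _; rewrite normrM ler_wpM2l // xB.
by rewrite ler_wpM2r ?row_sum_le //; lia.
Qed.

(** As [height <= B], a weight is at most 2 (height B)^2 <= 2 B^4; this gives the constant 2^m and
    the degree 4m. *)
Lemma tame_prefix_prod i : tame n (4 * m) height (2 ^+ m) (prefix_prod i).
Proof.
split=> [x y xy|x j u v|x|B x HB xB].
- apply: eq_bigr => h _; congr (if _ then _ else _).
  by congr (_ ^+ 2 *+ 2); apply: form_ext => k _; apply: xy.
- rewrite -eqz_mod_dvd; apply/eqP; rewrite /prefix_prod.
  apply: (big_rec2 (fun a b => (a = b %[mod u - v])%Z)) => // h a b _ ab.
  rewrite -modzMm ab modzMm; case: ifP => // _.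
  apply/eqP; rewrite -!/(weight _ _) eqz_mod_dvd -mulrBl dvdz_mulr //.
  have [jn|nj] := ltnP j n; last first.
    rewrite /weight (@form_ext h (upd x j u) (upd x j v)) ?subrr ?dvdz0 // => k kn.
    by rewrite /upd; case: eqP => //; lia.
  rewrite /weight !form_upd //; set f := form h x; set a' := row h j.
  (* The cofactor of u - v in a difference of two squares. *)
  apply/dvdzP; exists (2 * a' * (2 * f + a' * (u - x j) + a' * (v - x j))).
  ring.
- by apply: prodr_ge0 => h _; case: ifP => // _; apply: weight_ge0.
have B2 : 2 <= B by have := height_ge2; lia.
rewrite exprM -exprMn -[X in _ ^+ X]card_ord -prodr_const.
apply: ler_prod => h _; case: ifP => _; last first.
  by rewrite ler01 /= mulr_ege1 // exprn_ege1 //; lia.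
rewrite weight_ge0 /= /weight -mulr_natl ler_wpM2l //.
rewrite -[4%N]/(2 * 2)%N exprM -[form h x ^+ 2]real_normK ?num_real //.
rewrite ler_pXn2r ?nnegrE // ?exprn_ge0 //; last by lia.
apply: (le_trans (form_le (ltn_ord h) _ xB)); first lia.
by rewrite expr2 ler_wpM2r //; lia.
Qed.

Lemma minimal_upto_le i r j :
  minimal_upto i r -> (j < i)%N -> 0 <= r j <= height.
Proof.
move=> [_ _ rng] ji; have [-> /=] := rng j ji.
by have := pivots_le j; have := height_gtm; lia.
Qed.

Let pow_le c : (c <= n)%N -> (2 : int) ^+ m * 2 ^+ c <= height.
Proof.
move=> cn; rewrite -exprD; apply: le_trans height_ge.
by rewrite ler_weXn2l // leq_add2l.
Qed.

Lemma prefix_prod_splice i x :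
  prefix_prod i (splice i point x) = prefix_prod i point.
Proof. by apply: prefix_prod_ext => j ji; rewrite /splice ji. Qed.

Lemma eliminate_neq0P i (r x : nat -> int) c :
  (c <= n)%N -> (forall j, (j < c)%N -> 0 <= r j <= height) ->
  (forall j, (j < n)%N -> `|x j| <= height) ->
  reflect (exists y, [/\ signed c r y, forall j, (c <= j)%N -> y j = x j
                       & prefix_prod i y != 0])
          (eliminate point r c (prefix_prod i (splice c point x)) != 0).
Proof.
move=> cn rH xH.
rewrite (eliminateE (erefl _) levelS _ height_ge2 (tame_prefix_prod i)) //.
- exact: sign_sum_neq0P (tame_prefix_prod i) rH.
- exact: pow_le.
- exact: exprn_ge0.
Qed.

(** The test of the search phase, where no sign is fixed yet. Coordinates from [i] on do not enter
    [prefix_prod i] and may be set to 0. *)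
Lemma eliminate_prefix_prodP i (r : nat -> int) :
  (i <= n)%N -> (forall j, (j < i)%N -> 0 <= r j <= height) ->
  reflect (exists2 y, signed i r y & prefix_prod i y != 0)
          (eliminate point r i (prefix_prod i point) != 0).
Proof.
move=> i_n rH; rewrite -(prefix_prod_splice i (fun=> 0)).
have h0 j : (j < n)%N -> `|0 : int| <= height by have := height_ge2; lia.
apply: (iffP (eliminate_neq0P i i_n rH h0)) => [[y [? _ ?]]|[y ry yi]].
  by exists y.
exists (splice i y (fun=> 0)); split=> [j ji|j ij|].
- by rewrite /splice ji ry.
- by rewrite /splice ltnNge ij.
by rewrite (@prefix_prod_ext i _ y) // => j ji; rewrite /splice ji.
Qed.

(** For the sign phase: a single remainder commits entry [c] to one signed value, without a sum over
    both signs. *)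
Lemma prefix_prod_modz c (x : nat -> int) (v : int) :
  (c < n)%N -> (forall j, (j < n)%N -> `|x j| <= height) -> `|v| <= height ->
  (prefix_prod n (splice c.+1 point x) %% (point c - v))%Z
    = prefix_prod n (splice c point (upd x c v)).
Proof.
move=> cn xH vH.
rewrite (modz_tame (erefl _) levelS _ height_ge2 (tame_prefix_prod n)) //.
  by apply: prefix_prod_ext => j jn; rewrite /upd /splice; case: (eqVneq j c) => [->|]; rewrite ?ltnn.
rewrite -exprSr; apply: le_trans height_ge; rewrite ler_weXn2l //; lia.
Qed.

Lemma prefix_prod_modz_id c (x : nat -> int) :
  (c < n)%N -> (forall j, (j < n)%N -> `|x j| <= height) ->
  (prefix_prod n (splice c.+1 point x) %% (point c - x c))%Z
    = prefix_prod n (splice c point x).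
Proof.
move=> cn xH; rewrite prefix_prod_modz ?xH //; apply: prefix_prod_ext => j _.
by rewrite /splice /upd; case: ifP => // _; case: eqP => [->|].
Qed.

Lemma settledn r : minimal_upto n r -> settled n r r.
Proof.
move=> mr; split.
- by move=> j jn; have := minimal_upto_le mr jn; lia.
- by move=> j jn; have := minimal_upto_le mr jn; lia.
case: mr => [[y ry yn] _ _]; exists (splice n y r); split.
- by move=> j jn; rewrite /splice jn ry.
- by move=> j jn; rewrite /splice ltnNge jn.
by rewrite (@prefix_prod_ext n _ y) // => j ji; rewrite /splice ji.
Qed.

Lemma settled_le c r y :
  minimal_upto n r -> settled c r y -> forall j, (j < n)%N -> `|y j| <= height.
Proof.
by move=> mr [abs _ _] j jn; have := minimal_upto_le mr jn; rewrite abs //; lia.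
Qed.

Lemma settled_pos c r y :
  (c < n)%N -> minimal_upto n r -> settled c.+1 r y ->
  eliminate point y c (prefix_prod n (splice c point y)) != 0 ->
  settled c r y.
Proof.
move=> cn mr sy; have yH := settled_le mr sy; case: sy => abs ge0 _ e.
split=> //; first by move=> j jc; apply: ge0; lia.
apply/eliminate_neq0P => //; [lia|] => j jc.
by have := yH j; have := ge0 j; lia.
Qed.

(** A feasible [z] has |z_c| = y_c, and the failed test rules out z_c = y_c; hence z_c = -y_c. *)
Lemma settled_neg c r y :
  (c < n)%N -> minimal_upto n r -> settled c.+1 r y ->
  eliminate point y c (prefix_prod n (splice c point y)) = 0 ->
  settled c r (upd y c (- y c)).
Proof.
move=> cn mr sy e; have yH := settled_le mr sy.
case: sy => abs ge0 [z [yz zy zn]]; split.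
- by move=> j jn; rewrite /upd; case: eqP => [->|_]; rewrite ?normrN abs.
- by move=> j jc; rewrite /upd; case: eqP => [?|_]; [lia | apply: ge0; lia].
exists z; split=> // j jc.
  by rewrite /upd; case: eqP => [?|_]; [lia | apply: yz; lia].
rewrite /upd; case: eqP => [->|?]; last by apply: zy; lia.
have zc := yz c (ltnSn c); have [zyc|zyc] := eqVneq (z c) (y c); last by lia.
suff : eliminate point y c (prefix_prod n (splice c point y)) != 0.
  by rewrite e eqxx.
apply/eliminate_neq0P => //; first lia.
  by move=> k kc; have := yH k; have := ge0 k; lia.
exists z; split=> // k ck; first by apply: yz; lia.
by have [->|kc] := eqVneq k c => //; apply: zy; lia.
Qed.

End Arrangement.

(** * Running time and postconditions *)

(** [T] is only an upper bound, so budgets can be rounded up when composed; halting is part of the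
    claim. *)
Definition runs (P : prog) (st : state) (T : nat) (Q : state -> Prop) : Prop :=
  exists t st', [/\ exec P st t st', (t <= T)%N & Q st'].

Lemma runs_weaken P st T T' (Q Q' : state -> Prop) :
  runs P st T Q -> (T <= T')%N -> (forall st', Q st' -> Q' st') ->
  runs P st T' Q'.
Proof.
move=> [t [st' [e tT q]]] TT' qq'; exists t, st'; split=> //; last exact: qq'.
exact: leq_trans TT'.
Qed.

Lemma runs_skip st T (Q : state -> Prop) : Q st -> runs Skip st T Q.
Proof. by move=> q; exists 0%N, st; split=> //; constructor. Qed.

Lemma runs_seq P P' st T T' Q :
  runs P st T (fun st' => runs P' st' T' Q) -> runs (Seq P P') st (T + T') Q.
Proof.
move=> [t [st' [e tT [t' [st'' [e' tT' q]]]]]].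
by exists (t + t')%N, st''; split=> //; [exact: ExecSeq e e' | exact: leq_add].
Qed.

Lemma runs_const x c P st T Q :
  runs P (set_var st x c) T Q -> runs (Seq (Const x c) P) st T.+1 Q.
Proof.
by move=> h; apply: (@runs_seq _ _ _ 1); exists 1%N, (set_var st x c); split=> //; constructor.
Qed.

(** The value is named by an equation so that [step] can simplify it before substituting it into the
    state. *)
Lemma runs_arith o x y z P st T Q :
  (forall v, arith_eval o (vars st y) (vars st z) = v ->
     runs P (set_var st x v) T Q) ->
  runs (Seq (Arith o x y z) P) st T.+1 Q.
Proof.
move=> h; apply: (@runs_seq _ _ _ 1).
by exists 1%N; eexists; split; [constructor | | exact: h].
Qed.

Lemma runs_read x y P st T Q :
  (forall v, mem st (vars st y) = v -> runs P (set_var st x v) T Q) ->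
  runs (Seq (Read x y) P) st T.+1 Q.
Proof.
move=> h; apply: (@runs_seq _ _ _ 1).
by exists 1%N; eexists; split; [constructor | | exact: h].
Qed.

Lemma runs_write x y P st T Q :
  (forall a v, vars st x = a -> vars st y = v -> runs P (set_mem st a v) T Q) ->
  runs (Seq (Write x y) P) st T.+1 Q.
Proof.
move=> h; apply: (@runs_seq _ _ _ 1).
by exists 1%N; eexists; split; [constructor | | exact: h].
Qed.

Lemma runs_if b P P' st T Q :
  (test_eval b st -> runs P st T Q) -> (~~ test_eval b st -> runs P' st T Q) ->
  runs (If b P P') st T.+1 Q.
Proof.
move=> h h'; have [bt|bf] := boolP (test_eval b st).
  by have [t [st' [e tT q]]] := h bt; exists t.+1, st'; split=> //; apply: ExecIfTrue.
by have [t [st' [e tT q]]] := h' bf; exists t.+1, st'; split=> //; apply: ExecIfFalse.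
Qed.

Lemma runs_while_false b P st T (Q : state -> Prop) :
  ~~ test_eval b st -> Q st -> runs (While b P) st T.+1 Q.
Proof. by move=> bf q; exists 1%N, st; split=> //; constructor. Qed.

Lemma runs_while_true b P st T T' Q :
  test_eval b st -> runs P st T (fun st' => runs (While b P) st' T' Q) ->
  runs (While b P) st (T + T').+1 Q.
Proof.
move=> bt [t [st' [e tT [t' [st'' [e' tT' q]]]]]].
exists (t + t').+1, st''; split=> //; first exact: ExecWhileTrue bt e e'.
by rewrite ltnS leq_add.
Qed.

(** Each round pays one operation for its test; the outer successor pays for the final failing
    test. *)
Lemma runs_while_up b P (I : nat -> state -> Prop) N c st :
  (forall k st', I k st' -> (k <= N)%N -> test_eval b st' = (k < N)%N) ->
  (forall k st', (k < N)%N -> I k st' -> runs P st' (c k) (I k.+1)) ->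
  I 0%N st ->
  runs (While b P) st (\sum_(k < N) (c k).+1).+1 (I N).
Proof.
move=> test body I0.
suff up k st' : (k <= N)%N -> I k st' ->
    runs (While b P) st' (\sum_(k <= j < N) (c j).+1).+1 (I N).
  by rewrite -(big_mkord xpredT (fun j => (c j).+1)); apply: up.
move=> kN Ik; have [d Nk] : exists d, (N - k)%N = d by exists (N - k)%N.
elim: d k Nk kN st' Ik => [|d ih] k Nk kN st' Ik.
  have kE : k = N by lia.
  by apply: runs_while_false; [rewrite (test k) //; lia | rewrite -kE].
have k_lt : (k < N)%N by lia.
rewrite big_ltn // addSn -addnS.
apply: runs_while_true; first by rewrite (test k).
apply: runs_weaken (body k st' k_lt Ik) (leqnn _) _ => st''; apply: ih => //; lia.
Qed.

Lemma runs_while_down b P (I : nat -> state -> Prop) N c st :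
  (forall k st', I k st' -> test_eval b st' = (0 < k)%N) ->
  (forall k st', (k < N)%N -> I k.+1 st' -> runs P st' (c k) (I k)) ->
  I N st ->
  runs (While b P) st (\sum_(k < N) (c k).+1).+1 (I 0%N).
Proof.
move=> test; elim: N st => [|N ih] st body IN.
  by apply: runs_while_false => //; rewrite (test 0%N).
rewrite big_ord_recr /= addnS addnC -addnS.
apply: runs_while_true; first by rewrite (test N.+1).
apply: runs_weaken (body N st (ltnSn N) IN) (leqnn _) _ => st'; apply: ih.
by move=> k st'' kN; apply: body; lia.
Qed.

(** For a loop whose number of rounds is not known beforehand: the test can succeed only while
    [k < N]. *)
Lemma runs_while_search b P (I : nat -> state -> Prop) N c st :
  (forall k st', I k st' -> test_eval b st' ->
     (k < N)%N /\ runs P st' c (I k.+1)) ->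
  I 0%N st ->
  runs (While b P) st (N * c.+1).+1
    (fun st' => ~~ test_eval b st' /\ exists k, I k st').
Proof.
move=> body I0.
suff up k st' : I k st' -> runs (While b P) st' ((N - k) * c.+1).+1
    (fun st'' => ~~ test_eval b st'' /\ exists k, I k st'').
  by rewrite -[X in (X * _)%N]subn0; apply: up.
have [d Nk] : exists d, (N - k)%N = d by exists (N - k)%N.
elim: d k Nk st' => [|d ih] k Nk st' Ik;
  have [bt|bf] := boolP (test_eval b st');
  try by apply: runs_while_false => //; split=> //; exists k.
- by have [] := body k st' Ik bt; lia.
have [kN Pk] := body k st' Ik bt.
rewrite Nk mulSn addSn -addnS.
apply: runs_while_true => //.
apply: runs_weaken Pk (leqnn _) _ => st'' /ih; have -> : (N - k.+1)%N = d by lia.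
exact.
Qed.

Definition block (Ps : seq prog) : prog := foldr Seq Skip Ps.

Ltac step :=
  first [ apply: runs_const => /=
        | apply: runs_arith => ? /= <-
        | apply: runs_read => ? /= <-
        | apply: runs_write => ? ? /= <- <-
        | apply: runs_skip => /= ].

Definition consts (st : state) : Prop :=
  [/\ vars st 2 = 0, vars st 3 = 1 & vars st 4 = -1].

(** * The program *)

(* Expects D in register 20 and c in register 21; the registers below 20 are kept.
   Here and below, X_j is stored at address -1-j, r_j at address j, and registers
   2, 3, 4 hold 0, 1, -1. *)
Definition eliminate_prog : prog :=
  While (TestLt 2 21) (block
    [:: Arith Sub 21 21 3; Arith Sub 22 4 21; Read 22 22; Read 23 21;
        Arith Sub 24 22 23; Arith Add 25 22 23;
        Arith Div 26 20 24; Arith Mul 26 26 24; Arith Sub 26 20 26;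
        Arith Div 27 20 25; Arith Mul 27 27 25; Arith Sub 27 20 27;
        Arith Add 20 26 27]).

Lemma negz_address (c : nat) : -1 - c%:Z = Negz c.
Proof. by lia. Qed.

Lemma negz_address2 (c n : nat) : -1 - c%:Z - n%:Z = Negz (n + c).
Proof. by lia. Qed.

(** Quotient, product and difference yield a remainder. Thirteen instructions and one test make 14
    operations per round. *)
Lemma eliminate_progP X r c st :
  consts st -> vars st 21 = c%:Z ->
  (forall j, (j < c)%N -> mem st (Negz j) = X j) ->
  (forall j, (j < c)%N -> mem st (Posz j) = r j) ->
  runs eliminate_prog st (c * 14).+1 (fun st' =>
    [/\ mem st' = mem st, forall v, (v < 20)%N -> vars st' v = vars st v
      & vars st' 20 = eliminate X r c (vars st 20)]).
Proof.
move=> [z0 z1 z4] vc memX memr.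
pose I k st' := [/\ (k <= c)%N, mem st' = mem st,
  forall v, (v < 20)%N -> vars st' v = vars st v, vars st' 21 = k%:Z
  & eliminate X r k (vars st' 20) = eliminate X r c (vars st 20)].
have -> : (c * 14)%N = (\sum_(k < c) 14)%N by rewrite sum_nat_const card_ord.
apply: runs_weaken (runs_while_down (I := I) (c := fun=> 13) _ _ _) (leqnn _) _.
- by move=> k st' [_ _ fr v21 _] /=; rewrite fr // z0 v21.
- move=> k st' kc [_ em fr v21 e]; rewrite /block /=.
  do 14!step.
  have z2' := fr 2 isT; have z3' := fr 3 isT; have z4' := fr 4 isT.
  have v21' : vars st' 21 - vars st' 3 = k%:Z by rewrite v21 z3' z1; lia.
  rewrite v21' z4' z4 negz_address em memX // memr //.
  split=> //; first lia.
  by move=> v v20 /=; do !(case: eqP => [?|_]; first lia); apply: fr.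
- by split.
by move=> st' [_ em fr _ e].
Qed.

Section Correctness.

Variables (n m : nat) (inp : nat -> int).
Hypothesis row_neq0 :
  forall h, (h < m)%N -> exists2 j, (j < n)%N & row n inp h j != 0.

Definition registers (st : state) : Prop :=
  [/\ vars st 0 = n%:Z, vars st 1 = m%:Z & consts st].

Definition height_prog : prog := block
  [:: Arith Mul 6 0 1; Arith Add 6 6 1; Const 7 1; Const 5 0;
      While (TestLt 5 6) (block
        [:: Read 8 5; Arith Mul 8 8 8; Arith Add 7 7 7; Arith Add 7 7 8;
            Arith Add 5 5 3])].

Lemma height_progP st :
  registers st -> (forall k : nat, mem st k = inp k) ->
  runs height_prog st ((m * n.+1) * 6 + 5) (fun st' =>
    [/\ registers st', mem st' = mem st & vars st' 7 = height n m inp]).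
Proof.
move=> [v0 v1 [v2 v3 v4]] memi; rewrite /height_prog /block /=.
apply: (@runs_weaken _ _ ((m * n.+1 * 6).+1 + 0).+4); [|lia|by move=> st'; apply].
do 4!step.
set st1 := set_var _ _ _.
pose I k st' := [/\ registers st', mem st' = mem st, vars st' 5 = k%:Z,
  vars st' 6 = (m * n.+1)%N%:Z & vars st' 7 = height_upto inp k].
apply: runs_seq.
have -> : (m * n.+1 * 6)%N = (\sum_(k < m * n.+1) 6)%N.
  by rewrite sum_nat_const card_ord.
apply: runs_weaken (runs_while_up (I := I) (c := fun=> 5) _ _ _) (leqnn _) _.
- by move=> k st' [_ _ v5 v6 _] kN /=; rewrite v5 v6.
- move=> k st' kN [[v0' v1' [v2' v3' v4']] em v5 v6 v7]; rewrite /block /=.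
  do 6!step.
  split=> //=; first by rewrite v5 v3'; lia.
  by rewrite v7 v5 em memi mulr2n expr2.
- split=> //=; rewrite v0 v1; lia.
by move=> st' [rg em _ _ v7]; step.
Qed.

(** Register 7 is raised in place from one level to the next, so each point costs only O(m)
    operations. *)
Definition points_prog : prog := block
  [:: Const 5 0;
      While (TestLt 5 0) (block
        [:: Const 6 0;
            While (TestLt 6 1) (block
              [:: Arith Mul 7 7 7; Arith Mul 7 7 7; Arith Mul 7 7 7;
                  Arith Add 6 6 3]);
            Arith Sub 8 4 5; Write 8 7; Arith Sub 8 8 0; Write 8 3;
            Arith Add 5 5 3])].

Lemma points_progP st :
  registers st -> vars st 7 = height n m inp ->
  (forall k : nat, mem st k = inp k) ->
  runs points_prog st (n * (m * 5 + 8) + 2) (fun st' =>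
    [/\ registers st', forall k : nat, mem st' k = inp k,
      forall j, (j < n)%N -> mem st' (Negz j) = point n m inp j
    & forall j, (j < n)%N -> mem st' (Negz (n + j)) = 1]).
Proof.
move=> rg v7 memi; rewrite /points_prog /block /=.
apply: (@runs_weaken _ _ ((n * (m * 5 + 8)).+1 + 0).+1); [|lia|by move=> st'; apply].
step.
pose I k st' := [/\ registers st', vars st' 5 = k%:Z, vars st' 7 = level n m inp k
  & [/\ forall k : nat, mem st' k = inp k,
      forall j, (j < k)%N -> mem st' (Negz j) = point n m inp j
    & forall j, (j < k)%N -> mem st' (Negz (n + j)) = 1]].
apply: runs_seq.
have -> : (n * (m * 5 + 8))%N = (\sum_(k < n) (m * 5 + 7).+1)%N.
  by rewrite sum_nat_const card_ord; lia.
apply: runs_weaken (runs_while_up (I := I) (c := fun=> (m * 5 + 7)%N) _ _ _) (leqnn _) _.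
- by move=> k st' [[v0 _ _] v5 _ _] kN /=; rewrite v5 v0.
- move=> k st' kN [[v0' v1' [v2' v3' v4']] v5 v7' [mi mp m1]]; rewrite /block /=.
  apply: (@runs_weaken _ _ ((m * 5).+1 + 5).+1); [|lia|by move=> ?; apply].
  step.
  pose I' l st'' := [/\ registers st'', mem st'' = mem st', vars st'' 5 = k%:Z,
    vars st'' 6 = l%:Z & vars st'' 7 = level n m inp k ^+ (8 ^ l)].
  apply: runs_seq.
  have -> : (m * 5)%N = (\sum_(l < m) 5)%N by rewrite sum_nat_const card_ord.
  apply: runs_weaken (runs_while_up (I := I') (c := fun=> 4) _ _ _) (leqnn _) _.
  + by move=> l s [[_ v1 _] _ _ v6 _] lm /=; rewrite v6 v1.
  + move=> l s lm [[? ? [? v3 ?]] em v5' v6 v7'']; rewrite /block /=.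
    do 5!step.
    split=> //=; first by rewrite v6 v3; lia.
    by rewrite v7'' expnS [(8 * _)%N]mulnC exprM; ring.
  + by split.
  move=> s [[v0 v1 [v2 v3 v4]] em v5' _ v7'']; do 6!step.
  rewrite v0 v3 v4 v5' v7'' negz_address2 negz_address.
  split=> //=; first lia.
  split=> [a|j|j].
  + by rewrite em mi.
  + rewrite ltnS leq_eqVlt => /predU1P[->|jk].
      have -> : (Negz k == Negz (n + k)) = false by lia.
      by rewrite eqxx.
    have -> : (Negz j == Negz (n + k)) = false by lia.
    have -> : (Negz j == Negz k) = false by lia.
    by rewrite em mp.
  rewrite ltnS leq_eqVlt => /predU1P[->|jk]; first by rewrite eqxx.
  have -> : (Negz (n + j) == Negz (n + k)) = false by lia.
  have -> : (Negz (n + j) == Negz k) = false by lia.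
  by rewrite em m1.
- by split.
by move=> st' [rg' _ _ [mi mp m1]]; step.
Qed.

(* The product of the weights of the hyperplanes with pivot i is accumulated at
   address -1-n-i, which [points_prog] initialized to 1. *)
Definition products_prog : prog := block
  [:: Const 5 0; Const 6 0;
      While (TestLt 5 1) (block
        [:: Const 7 0; Const 8 0; Const 9 0;
            While (TestLt 9 0) (block
              [:: Read 10 6;
                  If (TestEq 10 2) Skip (block [:: Arith Add 8 9 2]);
                  Arith Sub 11 4 9; Read 11 11; Arith Mul 10 10 11;
                  Arith Add 7 7 10; Arith Add 6 6 3; Arith Add 9 9 3]);
            Read 10 6; Arith Sub 7 7 10; Arith Mul 7 7 7; Arith Add 7 7 7;
            Arith Add 6 6 3; Arith Sub 10 4 8; Arith Sub 10 10 0;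
            Read 11 10; Arith Mul 11 11 7; Write 10 11; Arith Add 5 5 3])].

Lemma products_progP st :
  registers st -> (forall k : nat, mem st k = inp k) ->
  (forall j, (j < n)%N -> mem st (Negz j) = point n m inp j) ->
  (forall j, (j < n)%N -> mem st (Negz (n + j)) = 1) ->
  runs products_prog st (m * (n * 10 + 17) + 3) (fun st' =>
    [/\ registers st',
      forall j, (j < n)%N -> mem st' (Negz j) = point n m inp j
    & forall j, (j < n)%N ->
        mem st' (Negz (n + j)) = class_prod n m inp j (point n m inp)]).
Proof.
set X := point n m inp; move=> rg mi mX m1; rewrite /products_prog /block /=.
apply: (@runs_weaken _ _ ((m * (n * 10 + 17)).+1 + 0).+2); [|lia|by move=> ?; apply].
do 2!step.
pose I h s := [/\ registers s, vars s 5 = h%:Z, vars s 6 = (h * n.+1)%N%:Z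
  & [/\ forall k : nat, mem s k = inp k,
      forall j, (j < n)%N -> mem s (Negz j) = X j
    & forall j, (j < n)%N -> mem s (Negz (n + j)) =
        \prod_(k < h) (if pivot n inp k == j then weight n inp k X else 1)]].
apply: runs_seq.
have -> : (m * (n * 10 + 17))%N = (\sum_(k < m) (n * 10 + 16).+1)%N.
  by rewrite sum_nat_const card_ord; lia.
apply: runs_weaken (runs_while_up (I := I) (c := fun=> (n * 10 + 16)%N) _ _ _) (leqnn _) _.
- by move=> h s [[_ v1 _] v5 _ _] _ /=; rewrite v5 v1.
- move=> h s hm [[v0 v1 [v2 v3 v4]] v5 v6 [smi smX smQ]]; rewrite /block /=.
  apply: (@runs_weaken _ _ ((n * 10).+1 + 11).+3); [|lia|by move=> ?; apply].
  do 3!step.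
  pose J j s' := [/\ registers s', mem s' = mem s, vars s' 5 = h%:Z,
      vars s' 6 = (h * n.+1 + j)%N%:Z
    & [/\ vars s' 7 = \sum_(k < j) row n inp h k * X k,
          vars s' 8 = (last_nonzero (row n inp h) j)%:Z & vars s' 9 = j%:Z]].
  apply: runs_seq.
  have -> : (n * 10)%N = (\sum_(l < n) 10)%N by rewrite sum_nat_const card_ord.
  apply: runs_weaken (runs_while_up (I := J) (c := fun=> 9) _ _ _) (leqnn _) _.
  + by move=> j s' [[u0 _ _] _ _ _ [_ _ u9]] _ /=; rewrite u9 u0.
  + move=> j s' jn [[u0 u1 [u2 u3 u4]] em u5 u6 [u7 u8 u9]]; rewrite /block /=.
    step; apply: (@runs_seq _ _ _ 2 6).
    have r10 : mem s' (vars s' 6) = row n inp h j by rewrite em u6 smi.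
    (* Both branches of the conditional continue with these instructions; their states differ at
       most in register 8. *)
    have rest s'' : vars s'' 8 = (last_nonzero (row n inp h) j.+1)%:Z ->
        (forall v, v != 8%N -> vars s'' v = vars (set_var s' 10 (row n inp h j)) v) ->
        mem s'' = mem s' ->
        runs (block [:: Arith Sub 11 4 9; Read 11 11; Arith Mul 10 10 11;
                  Arith Add 7 7 10; Arith Add 6 6 3; Arith Add 9 9 3]) s'' 6 (J j.+1).
      move=> w8 w em'; rewrite /block /=; do 7!step.
      have := (w 0 isT, w 1 isT, w 2 isT, w 3 isT, w 4 isT, w 5 isT, w 6 isT, w 7 isT, w 9 isT, w 10 isT)%N.
      rewrite /= u0 u1 u2 u3 u4 u5 u6 u7 u9 => -[[[[[[[[[w0 w1] w2] w3] w4] w5] w6] w7] w9] w10].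
      rewrite w3 w4 w6 w7 w9 w10 negz_address em' em smX //.
      split=> //=; [by rewrite em' | lia |].
      split=> //; last lia.
      by rewrite big_ord_recr.
    apply: runs_if => /=; rewrite u2 r10 => test.
      by apply: runs_skip; apply: rest => //=; rewrite test u8.
    rewrite /block /=; do 2!step; apply: rest => //=.
      by rewrite (negPf test) u9 u2 addr0.
    by move=> v /negPf ->.
  + by split=> //=; rewrite ?addn0 // big_ord0.
  move=> s' [[u0 u1 [u2 u3 u4]] em u5 u6 [u7 u8 u9]]; do 12!step.
  have [pn _ _] := last_nonzeroP (row_neq0 hm); rewrite -/(pivot n inp h) in pn u8.
  have r10 : mem s' (vars s' 6) = row n inp h n by rewrite em u6 smi.
  rewrite r10 u0 u3 u4 u5 u6 u7 u8 em negz_address2 negz_address smQ //.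
  rewrite -/(form n inp h X) -expr2 -mulr2n -/(weight n inp h X).
  split=> //=; [lia | lia |].
  split=> [a|j jn|j jn]; first by rewrite em.
    have -> : (Negz j == Negz (n + pivot n inp h)) = false by lia.
    by rewrite em smX.
  rewrite big_ord_recr /=; case: (eqVneq (pivot n inp h) j) => [->|ne].
    by rewrite eqxx.
  have -> : (Negz (n + j) == Negz (n + pivot n inp h)) = false by lia.
  by rewrite mulr1 em smQ.
- split=> //; split=> // j jn; by rewrite big_ord0 m1.
by move=> s [rg' _ _ [_ mX' mQ]]; step.
Qed.

(* The input is no longer needed, so the absolute values overwrite it from
   address 0 on. *)
Definition search_prog : prog := block
  [:: Const 7 1; Const 5 0;
      While (TestLt 5 0) (block
        [:: Arith Sub 8 4 5; Arith Sub 8 8 0; Read 8 8; Arith Mul 7 7 8;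
            If (TestEq 8 3)
              (block [:: Write 5 2])
              (block [:: Const 20 0; Const 6 0;
                 While (TestEq 20 2) (block
                   [:: Write 5 6; Arith Add 20 7 2; Arith Add 21 5 3;
                       eliminate_prog; Arith Add 6 6 3])]);
            Arith Add 5 5 3])].

Hypothesis m_gt0 : (0 < m)%N.

Local Notation X := (point n m inp).

Lemma search_progP st :
  registers st ->
  (forall j, (j < n)%N -> mem st (Negz j) = X j) ->
  (forall j, (j < n)%N -> mem st (Negz (n + j)) = class_prod n m inp j X) ->
  runs search_prog st (n * 11 + m * (n * 28 + 12) + 3) (fun st' =>
    [/\ registers st', forall j, (j < n)%N -> mem st' (Negz j) = X j,
        minimal_upto n m inp n (fun j => mem st' (Posz j))
      & vars st' 7 = prefix_prod n m inp n X]).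
Proof.
move=> rg mX mQ; rewrite /search_prog /block /=.
apply: (@runs_weaken _ _ ((n * 11 + m * (n * 28 + 12)).+1 + 0).+2);
  [|lia|by move=> ?; apply].
do 2!step.
pose I i s := [/\ registers s, vars s 5 = i%:Z,
    vars s 7 = prefix_prod n m inp i X,
    minimal_upto n m inp i (fun j => mem s (Posz j))
  & (forall j, (j < n)%N -> mem s (Negz j) = X j) /\
    (forall j, (j < n)%N -> mem s (Negz (n + j)) = class_prod n m inp j X)].
apply: runs_seq.
(* For k_i > 0 there are at most k_i + 1 <= 2 k_i tests of 14n + 6 operations each, and for k_i = 0
   there are none; the cost is charged to the hyperplanes with pivot [i]. *)
pose c i := (10 + pivots n m inp i * (n * 28 + 12))%N.
have -> : (n * 11 + m * (n * 28 + 12))%N = (\sum_(i < n) (c i).+1)%N.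
  rewrite -{1}(sum_pivots row_neq0) big_distrl /= /c.
  rewrite [RHS](eq_bigr (fun i : 'I_n => 11 + pivots n m inp i * (n * 28 + 12)))%N //.
  by rewrite big_split /= sum_nat_const card_ord.
apply: runs_weaken (runs_while_up (I := I) (c := c) _ _ _) (leqnn _) _.
- by move=> i s [[v0 _ _] v5 _ _ _] _ /=; rewrite v5 v0.
- move=> i s i_n [[v0 v1 [v2 v3 v4]] v5 v7 mini [sX sQ]]; rewrite /block /=.
  apply: (@runs_weaken _ _ ((pivots n m inp i * (n * 28 + 12) + 3).+1 + 1).+4);
    [|rewrite /c; lia|by move=> ?; apply].
  do 4!step.
  rewrite v0 v4 v5 v7 negz_address2 sQ // -prefix_prodS.
  set q := class_prod _ _ _ _ _; set s1 := set_var _ _ _.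
  pose r j := mem s (Posz j); rewrite -/r in mini.
  have rest s' : registers s' -> vars s' 5 = i%:Z ->
      vars s' 7 = prefix_prod n m inp i.+1 X ->
      minimal_upto n m inp i.+1 (fun j => mem s' (Posz j)) ->
      (forall j, mem s' (Negz j) = mem s (Negz j)) ->
      runs (Seq (Arith Add 5 5 3) Skip) s' 1 (I i.+1).
    move=> [u0 u1 [u2 u3 u4]] u5 u7 mini' neg; do 2!step.
    split=> //=; first by rewrite u5 u3; lia.
    by split=> j jn; rewrite neg; [apply: sX | apply: sQ].
  apply: runs_seq; apply: runs_if => /= q1.
    apply: (@runs_weaken _ _ 1); [|lia|by move=> ?; apply].
    do 2!step; apply: rest => //=; rewrite v2 v5; last by move=> j.
    apply: (minimal_uptoS0 row_neq0 i_n mini).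
    by apply: (@class_prod_eq1 _ _ _ _ X); apply/eqP; rewrite -v3.
  have k_gt0 : (0 < pivots n m inp i)%N.
    rewrite lt0n; apply/negP => /eqP k0; move/negP: q1; apply.
    by rewrite /q pivots0_class_prod // v3.
  (* [k] candidates have been tried, the last one being [k.-1], and register 20 holds its test
     value. For [k = 0] the 0 there is artificial and starts the loop. *)
  pose J k s' := [/\ registers s', vars s' 5 = i%:Z, vars s' 6 = k%:Z,
      vars s' 7 = prefix_prod n m inp i.+1 X
    & [/\ forall a, a != Posz i -> mem s' a = mem s a,
      at_least n m inp i r k.-1%:Z,
      (0 < k)%N -> mem s' (Posz i) = k.-1%:Z
    & vars s' 20 = if k is k'.+1 then
        eliminate X (upd r i k') i.+1 (prefix_prod n m inp i.+1 X) else 0]].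
  have candidate (k : nat) : at_least n m inp i r k%:Z ->
      forall j, (j < i.+1)%N -> 0 <= upd r i k j <= height n m inp.
    move=> lb j ji; have := at_least_le row_neq0 i_n mini lb.
    have := pivots_le n m inp i; have := height_gtm n inp m_gt0.
    rewrite /upd; case: eqP => [_|?]; first lia.
    by move=> _ _ _; apply: minimal_upto_le mini _ => //; lia.
  have more k s' : J k s' -> vars s' 20 = 0 -> at_least n m inp i r k%:Z.
    case: k => [|k] [_ _ _ _ [_ lb _ ->]] // e0; apply: at_least_succ => // ex.
    by move/(eliminate_prefix_prodP row_neq0 m_gt0 i_n (candidate _ lb)): ex;
      rewrite e0 eqxx.
  rewrite /block /=; apply: (@runs_weaken _ _
    (((pivots n m inp i).+1 * (n * 14 + 5).+1).+1 + 0).+2); [|nia|by move=> ?; apply].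
  do 2!step.
  apply: runs_seq; apply: runs_weaken (runs_while_search (I := J) _ _) (leqnn _) _.
  + move=> k s' Jk; have lb := more k s' Jk; move: Jk.
    move=> [[u0 u1 [u2 u3 u4]] u5 u6 u7 [frame _ _ _]] /= /eqP.
    rewrite u2 => /lb{}lb; split.
      (* The next candidate satisfies 2k <= k_i + 1, so k < k_i + 1. *)
      by have := at_least_le row_neq0 i_n mini lb; lia.
    rewrite /block /=; apply: (@runs_weaken _ _ ((i.+1 * 14).+1 + 1).+3);
      [|nia|by move=> ?; apply].
    do 3!step.
    rewrite u2 u3 u5 u6 u7 addr0.
    apply: runs_seq.
    apply: runs_weaken (eliminate_progP (X := X) (r := upd r i k) (c := i.+1) _ _ _ _) (leqnn _) _ => //=.
    * by lia.
    * by move=> j ji; rewrite frame // sX //; lia.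
    * move=> j _; rewrite /upd -[Posz j == Posz i]/(j == i); case: eqP => // ji.
      by rewrite frame //; apply/eqP => -[].
    move=> s2 [em fr v20]; do 2!step.
    split=> //=.
    * by split; rewrite /= ?fr //; split; rewrite /= fr.
    * by rewrite fr.
    * by rewrite !fr //= u3 u6; lia.
    * by rewrite fr.
    split=> //.
    * by move=> a ai; rewrite em /= (negPf ai) frame.
    * by rewrite em /= eqxx.
  + split=> //; split=> // z _ _; exact: normr_ge0.
  move=> s' [test [[|k] [[u0 u1 [u2 u3 u4]] u5 u6 u7 [frame lb]]]].
    by move=> _ e; move: test; rewrite /= e u2 eqxx.
  move=> /(_ isT) memk v20; step; apply: rest => //; last first.
    by move=> j; rewrite frame.
  (* The loop stopped on a successful test, so the last candidate [k] is feasible, while the smaller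
     ones have been ruled out. *)
  have [[y ry yi] lbs rng] : minimal_upto n m inp i.+1 (upd r i k).
    apply: minimal_uptoS => //.
    by apply/(eliminate_prefix_prodP row_neq0 m_gt0 i_n (candidate _ lb));
      move: test; rewrite /= v20 u2.
  have E j : (j < i.+1)%N -> mem s' (Posz j) = upd r i k j.
    move=> ji; rewrite /upd; case: eqP => [->//|ne].
    by rewrite frame //; apply/eqP => -[].
  split=> [|j ji|j ji]; last by rewrite E //; apply: rng.
    by exists y => // j ji; rewrite E // ry.
  rewrite E //; apply: eq_at_least (lbs j ji) => l lj; rewrite E //; lia.
- by split=> //=; [rewrite prefix_prod0 | apply: minimal_upto0].
by move=> s [rg' _ v7 mini [mX' _]]; step.
Qed.

(** Register 7 keeps the product with the final entries from index [c] on substituted. A test first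
    substitutes the nonnegative value and eliminates the earlier signs; a zero result flips the
    entry. The last remainder commits the chosen value. *)
Definition signs_prog : prog := block
  [:: Arith Add 5 0 2;
      While (TestLt 2 5) (block
        [:: Arith Sub 5 5 3; Read 6 5; Arith Sub 8 4 5; Read 8 8;
            If (TestEq 6 2) Skip (block
              [:: Arith Sub 9 8 6; Arith Div 10 7 9; Arith Mul 10 10 9;
                  Arith Sub 20 7 10; Arith Add 21 5 2; eliminate_prog;
                  If (TestEq 20 2) (block [:: Arith Sub 6 2 6; Write 5 6])
                    Skip]);
            Arith Sub 9 8 6; Arith Div 10 7 9; Arith Mul 10 10 9;
            Arith Sub 7 7 10])].

Lemma signs_progP st :
  let r j := mem st (Posz j) in
  registers st ->
  (forall j, (j < n)%N -> mem st (Negz j) = X j) ->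
  minimal_upto n m inp n r ->
  vars st 7 = prefix_prod n m inp n X ->
  runs signs_prog st (n * 10 + m * (n * 14 + 9) + 2) (fun st' =>
    settled n m inp 0 r (fun j => mem st' (Posz j))).
Proof.
move=> r rg mX mini v7; rewrite /signs_prog /block /=.
apply: (@runs_weaken _ _ ((n * 10 + m * (n * 14 + 9)).+1 + 0).+1);
  [|lia|by move=> ?; apply].
step.
pose entries s j := mem s (Posz j).
pose I c s := [/\ registers s, (c <= n)%N, vars s 5 = c%:Z,
    forall j, (j < n)%N -> mem s (Negz j) = X j
  & settled n m inp c r (entries s) /\
    vars s 7 = prefix_prod n m inp n (splice c X (entries s))].
apply: runs_seq.
pose c i := (9 + pivots n m inp i * (n * 14 + 9))%N.
have -> : (n * 10 + m * (n * 14 + 9))%N = (\sum_(i < n) (c i).+1)%N.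
  rewrite -{1}(sum_pivots row_neq0) big_distrl /= /c.
  rewrite [RHS](eq_bigr (fun i : 'I_n => 10 + pivots n m inp i * (n * 14 + 9)))%N //.
  by rewrite big_split /= sum_nat_const card_ord.
apply: runs_weaken (runs_while_down (I := I) (c := c) _ _ _) (leqnn _) _.
- by move=> k s [[_ _ [v2 _ _]] _ v5 _ _] /=; rewrite v5 v2.
- move=> k s kn [[v0 v1 [v2 v3 v4]] _ v5 sX [sett v7s]]; rewrite /block /=.
  apply: (@runs_weaken _ _ ((pivots n m inp k * (n * 14 + 9)).+1 + 4).+4);
    [|rewrite /c; lia|by move=> ?; apply].
  do 4!step.
  have -> : vars s 5 - vars s 3 = k%:Z by rewrite v5 v3; lia.
  rewrite v4 negz_address sX //.
  have yH := settled_le m_gt0 mini sett.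
  have rest s' : registers s' -> vars s' 5 = k%:Z ->
      vars s' 6 = entries s' k -> vars s' 7 = vars s 7 -> vars s' 8 = X k ->
      (forall j, mem s' (Negz j) = mem s (Negz j)) ->
      settled n m inp k r (entries s') ->
      modz (vars s 7) (X k - entries s' k) =
        prefix_prod n m inp n (splice k X (entries s')) ->
      runs (block [:: Arith Sub 9 8 6; Arith Div 10 7 9; Arith Mul 10 10 9;
                      Arith Sub 7 7 10]) s' 4 (I k).
    move=> [u0 u1 [u2 u3 u4]] u5 u6 u7 u8 neg sett' modE.
    rewrite /block /=; do 5!step.
    split=> //=; [exact: ltnW | by move=> j jn; rewrite neg sX |].
    by split=> //; rewrite u6 u7 u8.
  have kE : modz (vars s 7) (X k - entries s k) =
      prefix_prod n m inp n (splice k X (entries s)).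
    by rewrite v7s prefix_prod_modz_id.
  apply: runs_seq; apply: runs_if => /= [/eqP r0|/negbTE r_neq0].
    apply: runs_skip; apply: rest => //=.
    by apply: settled_eq0 sett _; rewrite /entries r0.
  (* If k_k = 0 then 2 r_k <= 1 and the entry is 0, so tests are run only at pivots and their cost
     can be charged to hyperplanes. *)
  have k_gt0 : (0 < pivots n m inp k)%N.
    rewrite lt0n; apply/negP => /eqP k0; move/negP: r_neq0; apply.
    case: sett => abs _ _; case: mini => _ _ /(_ k kn).
    by rewrite k0 v2 -abs // /entries; lia.
  rewrite /block /=; apply: (@runs_weaken _ _ (((k * 14).+1 + 3).+4.+1));
    [|nia|by move=> ?; apply].
  do 5!step.
  rewrite v2 addr0 -/(entries s k).
  rewrite -/(modz (vars s 7) (X k - entries s k)) kE.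
  apply: runs_seq.
  apply: runs_weaken (eliminate_progP (X := X) (r := entries s) (c := k) _ _ _ _) (leqnn _) _ => //=.
  + by move=> j jk; rewrite sX //; lia.
  move=> s2 [em fr v20].
  apply: (@runs_weaken _ _ (2.+1 + 0)); [|lia|by move=> ?; apply].
  apply: runs_seq; apply: runs_if => /= [/eqP e|/negbTE e].
    rewrite (fr 2) //= v2 in e; rewrite v20 in e.
    do 3!step; rewrite !fr //= v2 sub0r -/(entries s k); step.
    pose y := upd (entries s) k (- entries s k).
    set s3 := set_mem _ _ _.
    have yE : entries s3 = y by rewrite /entries /= em.
    have yk : y k = - entries s k by rewrite /y /upd eqxx.
    apply: rest; rewrite ?yE ?yk /= ?fr //=.
    * by split; rewrite /= ?fr //; split; rewrite /= fr.
    * by move=> j; rewrite em.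
    * exact: settled_neg.
    by rewrite v7s prefix_prod_modz ?normrN ?yH.
  apply: runs_skip; step.
  have yE : entries s2 = entries s by rewrite /entries em.
  apply: rest; rewrite ?yE ?fr //.
  * by split; rewrite /= ?fr //; split; rewrite /= fr.
  * by move=> j; rewrite em.
  apply: settled_pos => //; by rewrite -v20; move/negbT: e; rewrite (fr 2) //= v2.
- split=> //=; first by have [-> _ [-> _ _]] := rg; rewrite addr0.
  by split; [apply: settledn | rewrite v7 prefix_prod_splice].
by move=> s [_ _ _ _ [sett _]]; step.
Qed.

(** Without hyperplanes the memory is already zero, a valid result. Halting at once avoids the costs
    linear in n alone, which n m would not cover. *)
Definition main_prog : prog := block
  [:: Const 3 1;
      If (TestEq 1 2) Skip (block
        [:: Const 4 (-1); height_prog; points_prog; products_prog;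
            search_prog; signs_prog])].

Lemma main_progP st :
  vars st 0 = n%:Z -> vars st 1 = m%:Z -> vars st 2 = 0 ->
  (forall k : nat, mem st (Posz k) = inp k) ->
  runs main_prog st (n * m * 63 + m * 44 + n * 29 + 18) (fun st' =>
    let y j := mem st' (Posz j) in
    [/\ avoiding n m inp y, (\sum_(j < n) `|y j|) *+ 2 <= (m + n)%:Z
      & forall i z, (i < n)%N -> avoiding n m inp z ->
          (forall j, (j < i)%N -> `|z j| = `|y j|) -> `|y i| <= `|z i|]).
Proof.
move=> v0 v1 v2 memi; rewrite /main_prog.
apply: (@runs_weaken _ _ ((((m * n.+1) * 6 + 5) + ((n * (m * 5 + 8) + 2) +
  ((m * (n * 10 + 17) + 3) + ((n * 11 + m * (n * 28 + 12) + 3) +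
  ((n * 10 + m * (n * 14 + 9) + 2) + 0))))).+2 + 0).+1);
  [|lia|by move=> ?; apply].
rewrite /block /=; step; apply: runs_seq; apply: runs_if => /= [|_].
  by rewrite v1 v2; lia.
step; apply: runs_seq; apply: runs_weaken (height_progP _ _) (leqnn _) _ => //=.
move=> st1 [rg1 em1 h7]; apply: runs_seq.
apply: runs_weaken (points_progP rg1 h7 _) (leqnn _) _; first by rewrite em1.
move=> st2 [rg2 memi2 mX2 mQ2]; apply: runs_seq.
apply: runs_weaken (products_progP rg2 memi2 mX2 mQ2) (leqnn _) _.
move=> st3 [rg3 mX3 mQ3]; apply: runs_seq.
apply: runs_weaken (search_progP rg3 mX3 mQ3) (leqnn _) _.
move=> st4 [rg4 mX4 mini v7]; apply: runs_seq.
apply: runs_weaken (signs_progP rg4 mX4 mini v7) (leqnn _) _.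
move=> st5 sett; do 2!step.
exact: settled0_optimal sett.
Qed.

End Correctness.

(** * Hyperplanes and vectors in the flat input format *)

Lemma nth_flatten_encode n (s : seq ('cV[int]_n * int)) p0 h j :
  (h < size s)%N -> (j < n.+1)%N ->
  nth 0 (flatten (map (@encode n) s)) (h * n.+1 + j) = nth 0 (encode (nth p0 s h)) j.
Proof.
have size_encode p : size (@encode n p) = n.+1.
  by rewrite size_rcons size_map size_enum_ord.
elim: s h => // p s ih [|h] hs jn; rewrite /= nth_cat size_encode; first by rewrite jn.
by rewrite mulSn -addnA ltnNge leq_addr /= addKn ih.
Qed.

(** Entries from index [n] on are filled with 0; no form reads them. *)
Definition coordinates n (z : 'cV[int]_n) (j : nat) : int :=
  if insub j is Some i then z i 0 else 0.

Lemma coordinatesE n (z : 'cV[int]_n) (i : 'I_n) : coordinates z i = z i 0.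
Proof. by rewrite /coordinates valK. Qed.

Section Encoding.

Variables (n : nat) (A : {fset 'cV[int]_n * int}) (s : seq ('cV[int]_n * int)).
Hypothesis sA : s =i A.

Let inp k := nth 0 (flatten (map (@encode n) s)) k.

Lemma row_encode p0 h j (jn : (j < n)%N) :
  (h < size s)%N -> row n inp h j = (nth p0 s h).1 (Ordinal jn) 0.
Proof.
move=> hs; rewrite /row /inp (nth_flatten_encode p0) //; last exact: ltnW.
rewrite nth_rcons size_map size_enum_ord jn (nth_map (Ordinal jn)) ?size_enum_ord //.
by rewrite (_ : nth _ _ _ = Ordinal jn) //; apply: val_inj; rewrite /= nth_enum_ord.
Qed.

Lemma form_encode p0 h (y : 'cV[int]_n) :
  (h < size s)%N ->
  form n inp h (coordinates y) = ((nth p0 s h).1^T *m y) 0 0 - (nth p0 s h).2.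
Proof.
move=> hs; rewrite /form mxE; congr (_ - _).
  apply: eq_bigr => j _; rewrite mxE coordinatesE (row_encode p0 (ltn_ord j)) //.
  by congr (_ * _); congr (fun_of_matrix _ _ _); apply: val_inj.
by rewrite /row /inp (nth_flatten_encode p0) // nth_rcons size_map size_enum_ord ltnn eqxx.
Qed.

Lemma avoiding_encode (y : 'cV[int]_n) :
  avoiding n (size s) inp (coordinates y) <-> avoids A y.
Proof.
split=> [ay p|ay h hs].
  rewrite -sA => ps; have := ay (index p s); rewrite index_mem => /(_ ps).
  by rewrite (form_encode p) ?index_mem // nth_index // subr_eq0.
have p0 : 'cV[int]_n * int := (0, 0).
rewrite (form_encode p0) // subr_eq0; apply: ay; rewrite -sA; exact: mem_nth.
Qed.

Lemma row_neq0_encode :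
  (forall p, p \in A -> p.1 != 0) ->
  forall h, (h < size s)%N -> exists2 j, (j < n)%N & row n inp h j != 0.
Proof.
move=> A0 h hs; pose p0 : 'cV[int]_n * int := (0, 0).
have := A0 (nth p0 s h); rewrite -sA mem_nth // => /(_ isT).
move=> nz; have [j nzj] : exists j, (nth p0 s h).1 j 0 != 0.
  apply/existsP; apply: contraNT nz => /existsPn z; apply/eqP/colP => j.
  by rewrite mxE; apply/eqP; have := z j; rewrite negbK.
exists j => //; rewrite (row_encode p0 (ltn_ord j)) //.
by rewrite (_ : Ordinal _ = j) //; apply: val_inj.
Qed.

End Encoding.

Theorem theorem4 :
  exists (P : prog) (C : nat),
    forall (n : nat) (A : {fset 'cV[int]_n * int})
           (s : seq ('cV[int]_n * int)),
      (1 <= n)%N ->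
      (forall p : 'cV[int]_n * int, p \in A -> p.1 != 0) ->
      uniq s -> s =i A ->
      exists (t : nat) (st : state),
        let m := #|` A|%fset in
        let y := output n st in
        [/\ exec P (input_state s) t st,
            avoids A y,
            (t <= C * maxn 1 (n * m))%N,
            (l1norm y)%:~R <= (m + n)%:R / 2%:R :> rat
          & lex_minimal A y].
Proof.
(* 154 = 63 + 44 + 29 + 18: for positive n and m, each term of the running time is at most its
   coefficient times n m. *)
exists main_prog, 154%N => n A s n_gt0 A0 us sA.
have -> : #|` A|%fset = size s by apply/perm_size/uniq_perm.
have [s0|m_gt0] := posnP (size s).
  have [t [st [e t2 stE]]] : runs main_prog (input_state s) 2 (eq (set_var (input_state s) 3 1)).
    rewrite /main_prog /block /=; step; apply: (@runs_seq _ _ _ 1 0).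
    by apply: runs_if; rewrite /= s0 // => _; do 2!step.
  have out0 (i : 'I_n) : output n st i 0 = 0.
    by rewrite mxE -stE /= (size0nil s0) nth_nil.
  exists t, st; split=> //.
  - by move=> p; rewrite -sA; move/size0nil: s0 => ->.
  - by rewrite s0 muln0; lia.
  - by rewrite /l1norm big1 ?divr_ge0 // => i _; rewrite out0.
  - by move=> i z _ _; rewrite out0.
pose inp k := nth 0 (flatten (map (@encode n) s)) k.
have nz := row_neq0_encode sA A0.
have [t [st [e tT [ay sum lex]]]] :=
  main_progP (n := n) (inp := inp) nz m_gt0 (st := input_state s) erefl erefl erefl (fun=> erefl).
have outE (j : nat) : (j < n)%N -> coordinates (output n st) j = mem st (Posz j).
  by move=> jn; rewrite -[j]/(val (Ordinal jn)) coordinatesE mxE.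
exists t, st; split=> //.
- apply/(avoiding_encode sA) => h hs.
  by rewrite (@form_ext _ _ _ _ (fun j => mem st (Posz j))) ?ay.
- apply: leq_trans tT _; rewrite (maxn_idPr _); nia.
- rewrite ler_pdivlMr //.
  have -> : l1norm (output n st) = \sum_(j < n) `|mem st (Posz j)|.
    by apply: eq_bigr => j _; rewrite mxE.
  by rewrite mulr_natr -rmorphMn /= [leRHS]pmulrn ler_int.
move=> i z /(avoiding_encode sA) az zy; rewrite mxE.
rewrite -(coordinatesE z); apply: lex => // j ji.
have jn : (j < n)%N by apply: ltn_trans ji _.
by rewrite -[j]/(val (Ordinal jn)) coordinatesE zy // mxE.
Qed.
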